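(* Let $(A,\cdot,\Delta)$ be an ASI bialgebra and let $\partial,\eth\colon A\to A$ be linear maps. Then the following conditions are equivalent: (1) $(A,\cdot,\Delta,\{\partial\},\{\eth\})$ is a differential ASI bialgebra. (2) $(\partial,\eth)$ is a coherent derivation on the ASI bialgebra $(A,\cdot,\Delta)$. (3) $\partial+\eth^*$ is a derivation on the algebra $(A\bowtie A^*,\star)$ built on $A\oplus A^*$ from the matched pair of algebras $((A,\cdot),(A^*,\circ),R_A^*,L_A^*,R_{A^*}^*,L_{A^*}^* )$, where the algebra structure $\circ$ on $A^*$ is given by $\Delta^*$.
   Context: All vector spaces and algebras are finite-dimensional over a field $\mathbb F$ of characteristic $0$; ''algebra'' means associative algebra, not necessarily unital. $\sigma(a\otimes b)=b\otimes a$; $L_A(a)b=a\cdot b=R_A(b)a$. For a linear map $\varphi$, $\varphi^*$ is its transpose; for $\mu\colon A\to\mathrm{End}(V)$, $\mu^*(a)=\mu(a)^*$ (no sign). $\partial+\eth^*$ denotes $a+a^*\mapsto\partial(a)+\eth^*(a^* )$ on $A\oplus A^*$. ASI bialgebra $(A,\cdot,\Delta)$: $(A,\cdot)$ is an algebra, $(A,\Delta)$ is a coassociative coalgebra (counit not required), and for all $a,b\in A$ $$\Delta(a\cdot b)=(R_A(b)\otimes\mathrm{id})\Delta(a)+(\mathrm{id}\otimes L_A(a))\Delta(b),$$ $$(L_A(a)\otimes\mathrm{id}-\mathrm{id}\otimes R_A(a))\Delta(b)=\sigma\big((\mathrm{id}\otimes R_A(b)-L_A(b)\otimes\mathrm{id})\Delta(a)\big).$$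 The product on $A\bowtie A^*=A\oplus A^*$ (which is associative for an ASI bialgebra, with $\circ=\Delta^*$) is $$(a+a^* )\star(b+b^* )=(a\cdot b+L_{A^*}^*(b^* )a+R_{A^*}^*(a^* )b)+(a^*\circ b^*+R_A^*(a)b^*+L_A^*(b)a^* ),$$ where $L_{A^*},R_{A^*}$ are left and right multiplications of $(A^*,\circ)$ and $A^{**}=A$. Coherent derivation on $(A,\cdot,\Delta)$: a pair $(\partial,\eth)$ of linear maps $A\to A$ with $\partial$ a derivation of $(A,\cdot)$, $\eth$ a coderivation of $(A,\Delta)$ (i.e. $\Delta\eth=(\eth\otimes\mathrm{id}+\mathrm{id}\otimes\eth)\Delta$), such that for all $a,b\in A$: $\eth(a)\cdot b=a\cdot\partial(b)+\eth(a\cdot b)$, $a\cdot\eth(b)=\partial(a)\cdot b+\eth(a\cdot b)$, $(\partial\otimes\mathrm{id})\Delta=(\mathrm{id}\otimes\eth)\Delta+\Delta\partial$, $(\mathrm{id}\otimes\partial)\Delta=(\eth\otimes\mathrm{id})\Delta+\Delta\partial$. Differential ASI bialgebra $(A,\cdot,\Delta,\Phi=\{\partial_k\}_{k=1}^m,\Psi=\{\eth_k\}_{k=1}^m)$: $(A,\cdot,\Delta)$ is an ASI bialgebra; $(A,\cdot,\Phi)$ is a differential algebra (the $\partial_k$ are pairwise commuting derivations of $(A,\cdot)$); $(A,\Delta,\Psi)$ is a differential coalgebra (the $\eth_k$ are pairwise commuting coderivations of $(A,\Delta)$); $\Psi$ is admissible to $(A,\cdot,\Phi)$, meaning $(A^*,R_A^*,L_A^*,\Psi^*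 )$ is a bimodule of the differential algebra $(A,\cdot,\Phi)$; and $\Phi^*$ is admissible to $(A^*,\Delta^*,\Psi^* )$ in the same sense. Here a bimodule of a differential algebra $(A,\cdot,\{\partial_k\})$ is an $A$-bimodule $(V,l,r)$ (that is, $l(a)l(b)=l(a\cdot b)$, $r(b)r(a)=r(a\cdot b)$, $r(b)l(a)=l(a)r(b)$) with commuting linear maps $\alpha_k$ on $V$ satisfying $\alpha_k(l(a)v)=l(\partial_k(a))v+l(a)\alpha_k(v)$, $\alpha_k(r(a)v)=r(\partial_k(a))v+r(a)\alpha_k(v)$. *)

(* Defs.v *)
From HB Require Import structures.
From mathcomp Require Import all_boot all_order all_algebra.

Set Implicit Arguments.
Unset Strict Implicit.
Unset Printing Implicit Defensive.

Import GRing.Theory.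
Local Open Scope ring_scope.

Reserved Notation "f \ot g" (at level 40, left associativity).

(* Tensor products: an element of [tensor V W] is given by its matrix of
   coordinates in the bases [vbasis] of V and W.  By [tlift_pure] (universal
   property) and [tensor_ext] this choice of bases is immaterial: all the maps
   below are determined by their values on pure tensors. *)

Section Tensor.
Variable F : fieldType.
Implicit Types U V W : vectType F.

Definition tensor V W : vectType F := 'M[F]_(\dim {:V}, \dim {:W}).

Definition pure V W (v : V) (w : W) : tensor V W :=
  \matrix_(i, j) (coord (vbasis {:V}) i v * coord (vbasis {:W}) j w).

(* The linear map out of [tensor V W] induced by a bilinear map [b]. *)
Definition tlift V W U (b : V -> W -> U) : 'Hom(tensor V W, U) :=
  linfun (fun t : 'M[F]_(\dim {:V}, \dim {:W}) =>
    \sum_i \sum_j t i j *: b (vbasis {:V})`_i (vbasis {:W})`_j).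

Lemma vbasis_sum V (v : V) :
  v = \sum_i coord (vbasis {:V}) i v *: (vbasis {:V})`_i.
Proof. exact: coord_vbasis (memvf v). Qed.

Lemma pureDl V W (v v' : V) (w : W) : pure (v + v') w = pure v w + pure v' w.
Proof. by apply/matrixP => i j; rewrite !mxE linearD mulrDl. Qed.

Lemma pureDr V W (v : V) (w w' : W) : pure v (w + w') = pure v w + pure v w'.
Proof. by apply/matrixP => i j; rewrite !mxE linearD mulrDr. Qed.

Lemma pureZl V W k (v : V) (w : W) : pure (k *: v) w = k *: pure v w.
Proof. by apply/matrixP => i j; rewrite !mxE linearZ mulrA. Qed.

Lemma pureZr V W k (v : V) (w : W) : pure v (k *: w) = k *: pure v w.
Proof. by apply/matrixP => i j; rewrite !mxE linearZ /= mulrCA. Qed.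

Lemma tlift_linear V W U (b : V -> W -> U) :
  linear (fun t : 'M[F]_(\dim {:V}, \dim {:W}) =>
    \sum_i \sum_j t i j *: b (vbasis {:V})`_i (vbasis {:W})`_j).
Proof.
move=> k s t; rewrite scaler_sumr -big_split; apply: eq_bigr => i _ /=.
rewrite scaler_sumr -big_split; apply: eq_bigr => j _ /=.
by rewrite !mxE scalerDl scalerA.
Qed.

Lemma tliftE V W U (b : V -> W -> U) (t : tensor V W) :
  tlift b t = \sum_i \sum_j (t : 'M[F]_(_, _)) i j *: b (vbasis {:V})`_i (vbasis {:W})`_j.
Proof.
pose bL := GRing.isLinear.Build F (tensor V W) U *:%R _ (tlift_linear b).
pose bl : {linear tensor V W -> U} := HB.pack
  (fun t : 'M[F]_(\dim {:V}, \dim {:W}) =>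
    \sum_i \sum_j t i j *: b (vbasis {:V})`_i (vbasis {:W})`_j) bL.
exact: (lfunE bl).
Qed.

Lemma tlift_pure V W U (b : V -> W -> U) v w :
  (forall x, linear (b x)) -> (forall y, linear (b^~ y)) ->
  tlift b (pure v w) = b v w.
Proof.
move=> blin1 blin2; rewrite tliftE.
have lsum1 x (n : nat) (f : 'I_n -> F) (g : 'I_n -> W) :
    b x (\sum_i f i *: g i) = \sum_i f i *: b x (g i).
  pose bL := GRing.isLinear.Build F W U *:%R _ (blin1 x).
  pose bl : {linear W -> U} := HB.pack (b x) bL.
  by rewrite -[b x]/(bl : W -> U) linear_sum; apply: eq_bigr => i _; rewrite linearZ.
have lsum2 y (n : nat) (f : 'I_n -> F) (g : 'I_n -> V) :
    b (\sum_i f i *: g i) y = \sum_i f i *: b (g i) y.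
  pose bL := GRing.isLinear.Build F V U *:%R _ (blin2 y).
  pose bl : {linear V -> U} := HB.pack (b^~ y) bL.
  rewrite -[LHS]/(bl _) linear_sum.
  by apply: eq_bigr => i _; rewrite linearZ.
rewrite [in RHS](vbasis_sum v) lsum2; apply: eq_bigr => i _.
rewrite [in RHS](vbasis_sum w) lsum1 scaler_sumr; apply: eq_bigr => j _.
by rewrite mxE scalerA.
Qed.

Lemma tensor_ext V W U (f g : 'Hom(tensor V W, U)) :
  (forall v w, f (pure v w) = g (pure v w)) -> f = g.
Proof.
move=> fg; apply/lfunP => t.
rewrite [t](matrix_sum_delta (t : 'M[F]_(_, _))) !linear_sum.
apply: eq_bigr => i _; rewrite !linear_sum; apply: eq_bigr => j _.
rewrite !linearZ; congr (_ *: _).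
suff : delta_mx i j = pure (vbasis {:V})`_i (vbasis {:W})`_j :> tensor V W.
  by move=> ->; exact: fg.
apply/matrixP => k l; rewrite !mxE.
rewrite !coord_free ?(basis_free (vbasisP fullv)) // -natrM mulnb.
by rewrite (eq_sym k) (eq_sym l).
Qed.

Definition tmap V V' W W' (f : 'Hom(V, V')) (g : 'Hom(W, W')) :
    'Hom(tensor V W, tensor V' W') :=
  tlift (fun v w => pure (f v) (g w)).

Lemma tmapE V V' W W' (f : 'Hom(V, V')) (g : 'Hom(W, W')) v w :
  tmap f g (pure v w) = pure (f v) (g w).
Proof.
by apply: tlift_pure => [x k y z|y k x z];
  rewrite linearP ?(pureDl, pureDr, pureZl, pureZr).
Qed.

Definition tswap V W : 'Hom(tensor V W, tensor W V) :=
  tlift (fun v w => pure w v).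

Lemma tswapE V W (v : V) (w : W) : tswap V W (pure v w) = pure w v.
Proof.
by apply: tlift_pure => [x k y z|y k x z];
  rewrite ?(pureDl, pureDr, pureZl, pureZr).
Qed.

Definition tassoc U V W :
    'Hom(tensor (tensor U V) W, tensor U (tensor V W)) :=
  tlift (fun t w => tlift (fun u v => pure u (pure v w)) t).

Lemma tassocE U V W (u : U) (v : V) (w : W) :
  tassoc U V W (pure (pure u v) w) = pure u (pure v w).
Proof.
have inner w' u' v' :
    tlift (fun u v => pure u (pure v w')) (pure u' v') = pure u' (pure v' w').
  by apply: tlift_pure => [x k y z|y k x z];
    rewrite ?(pureDl, pureDr, pureZl, pureZr).
rewrite /tassoc tlift_pure ?inner // => [t k y z|y k s t]; last first.
  by rewrite linearP.
pose f w' : 'Hom(tensor U V, tensor U (tensor V W)) :=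
  tlift (fun u v => pure u (pure v w')).
rewrite -[LHS]/(f (k *: y + z) t) -[RHS]/(k *: f y t + f z t).
suff -> : f (k *: y + z) = k *: f y + f z by rewrite add_lfunE scale_lfunE.
apply: tensor_ext => u' v'.
by rewrite add_lfunE scale_lfunE /f !inner !(pureDr, pureZr).
Qed.

End Tensor.

Notation "f \ot g" := (tmap f g) : ring_scope.

Section Dual.
Variable F : fieldType.
Local Notation dual V := 'Hom(V, F^o).
Implicit Types U V W : vectType F.

Definition transpose V W (f : 'Hom(V, W)) : 'Hom(dual W, dual V) :=
  linfun (fun phi : dual W => (phi \o f)%VF).

Lemma transposeE V W (f : 'Hom(V, W)) (phi : dual W) v :
  transpose f phi v = phi (f v).
Proof.
have lin : linear (fun phi : dual W => (phi \o f)%VF).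
  by move=> k x y; rewrite comp_lfunDl comp_lfunZl.
pose L := GRing.isLinear.Build F (dual W) (dual V) *:%R _ lin.
pose l : {linear (dual W) -> (dual V)} :=
  HB.pack (fun phi : dual W => (phi \o f)%VF) L.
by rewrite /transpose (lfunE l) /= comp_lfunE.
Qed.

Definition bidual V : 'Hom(V, dual (dual V)) :=
  linfun (fun v : V => linfun (fun phi : dual V => phi v)).

Lemma bidualE V (v : V) (phi : dual V) : bidual V v phi = phi v.
Proof.
have lin1 u : linear (fun phi : dual V => phi u).
  by move=> k x y; rewrite add_lfunE scale_lfunE.
pose L1 u := GRing.isLinear.Build F (dual V) F^o *:%R _ (lin1 u).
pose l1 u : {linear (dual V) -> F^o} :=
  HB.pack (fun phi : dual V => phi u) (L1 u).
have lin : linear (fun u : V => linfun (l1 u)).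
  by move=> k x y; apply/lfunP => p;
    rewrite add_lfunE scale_lfunE !lfunE /= linearP.
pose L := GRing.isLinear.Build F V (dual (dual V)) *:%R _ lin.
pose l : {linear V -> (dual (dual V))} :=
  HB.pack (fun u : V => linfun (l1 u)) L.
by rewrite /bidual (lfunE l) /= (lfunE (l1 v)).
Qed.

Lemma bidual_inj V : injective (bidual V).
Proof.
move=> u v uv; rewrite (vbasis_sum u) (vbasis_sum v).
apply: eq_bigr => i _; congr (_ *: _).
pose phi : dual V := 
  linfun (coord (vbasis {:V}) i : V -> F^o).
have := congr1 (fun h : (dual (dual V)) => h phi) uv.
by rewrite !bidualE !lfunE.
Qed.

Lemma limg_bidual V : limg (bidual V) = fullv.
Proof.
apply/eqP; rewrite eqEdim subvf limg_dim_eq; last first.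
  have -> : lker (bidual V) = 0%VS; last by rewrite capv0.
  by apply/eqP/lker0P; exact: bidual_inj.
have dim_dual U : dim (dual U) = dim U by exact: muln1.
by rewrite !dimvf (etrans (dim_dual _) (dim_dual V)) /= leqnn.
Qed.

(* [bidual V] is bijective, so its inverse realises the identification
   V^** = V; endomorphisms of V^** are transported along it. *)
Definition from_bidual V (f : 'End(dual (dual V))) : 'End(V) :=
  ((bidual V)^-1 \o f \o bidual V)%VF.

Lemma from_bidualE V f (v : V) : bidual V (from_bidual f v) = f (bidual V v).
Proof.
by rewrite /from_bidual !comp_lfunE limg_lfunVK // limg_bidual memvf.
Qed.

(* The pairing of phi \otimes psi in A^* \otimes A^* with A \otimes A. *)
Definition tpair V W (phi : dual V) (psi : dual W) : dual (tensor V W) :=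
  tlift (fun v w => phi v * psi w : F^o).

Lemma tpairE V W (phi : dual V) (psi : dual W) v w :
  tpair phi psi (pure v w) = phi v * psi w.
Proof.
apply: tlift_pure => [x k y z|y k x z]; rewrite linearP /=.
  by rewrite mulrDr /GRing.scale /= mulrCA.
by rewrite mulrDl /GRing.scale /= mulrA.
Qed.

End Dual.

Section Algebra.
Variable F : fieldType.
Local Notation dual V := 'Hom(V, F^o).
Implicit Types A V : vectType F.

Definition lmul A (mu : {bilinear A -> A -> A}) : 'Hom(A, 'End(A)) :=
  linfun (fun a => linfun (mu a)).

Definition rmul A (mu : {bilinear A -> A -> A}) : 'Hom(A, 'End(A)) :=
  linfun (fun b => linfun (applyr mu b)).

Lemma lmulE A (mu : {bilinear A -> A -> A}) a b : lmul mu a b = mu a b.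
Proof.
have lin : linear (fun a => linfun (mu a)).
  move=> k x y; apply/lfunP => z.
  rewrite add_lfunE scale_lfunE !lfunE.
  by rewrite -[LHS]/(applyr mu z (k *: x + y)) linearP.
pose L := GRing.isLinear.Build F A 'End(A) *:%R _ lin.
pose l : {linear A -> 'End(A)} := HB.pack (fun a => linfun (mu a)) L.
by rewrite /lmul (lfunE l) /= lfunE.
Qed.

Lemma rmulE A (mu : {bilinear A -> A -> A}) a b : rmul mu b a = mu a b.
Proof.
have lin : linear (fun b => linfun (applyr mu b)).
  move=> k x y; apply/lfunP => z.
  by rewrite add_lfunE scale_lfunE !lfunE /= linearP.
pose L := GRing.isLinear.Build F A 'End(A) *:%R _ lin.
pose l : {linear A -> 'End(A)} := HB.pack (fun b => linfun (applyr mu b)) L.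
by rewrite /rmul (lfunE l) /= lfunE.
Qed.

Definition dualrep A V (l : 'Hom(A, 'End(V))) : 'Hom(A, 'End(dual V)) :=
  linfun (fun a => transpose (l a)).

Lemma dualrepE A V (l : 'Hom(A, 'End(V))) a (phi : dual V) v :
  dualrep l a phi v = phi (l a v).
Proof.
have lin : linear (fun a => transpose (l a)).
  move=> k x y; apply/lfunP => p; apply/lfunP => z.
  by rewrite !(add_lfunE, scale_lfunE, transposeE, linearP).
pose L := GRing.isLinear.Build F A 'End(dual V) *:%R _ lin.
pose h : {linear A -> 'End(dual V)} :=
  HB.pack (fun a => transpose (l a)) L.
by rewrite /dualrep (lfunE h) /= transposeE.
Qed.

Definition coassociative A (Delta : 'Hom(A, tensor A A)) : Prop :=
  forall a, tassoc A A A ((Delta \ot \1%VF) (Delta a)) = (\1%VF \ot Delta) (Delta a).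

(* The product Delta^* on A^*, via A^* \otimes A^* = (A \otimes A)^*. *)
Definition dual_mul A (Delta : 'Hom(A, tensor A A)) (phi psi : dual A) :
    (dual A) :=
  (tpair phi psi \o Delta)%VF.

Lemma dual_mul_bilinear A (Delta : 'Hom(A, tensor A A)) :
  bilinear_for *:%R *:%R (dual_mul Delta).
Proof.
have tpairPl k (x y z : dual A) :
    tpair (k *: x + y) z = k *: tpair x z + tpair y z.
  apply: tensor_ext => a b; rewrite !(add_lfunE, scale_lfunE, tpairE).
  by rewrite mulrDl /GRing.scale /= mulrA.
have tpairPr k (x y z : dual A) :
    tpair z (k *: x + y) = k *: tpair z x + tpair z y.
  apply: tensor_ext => a b; rewrite !(add_lfunE, scale_lfunE, tpairE).
  by rewrite mulrDr /GRing.scale /= mulrCA.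
split=> z k x y; rewrite /dual_mul /applyr_head.
  by rewrite tpairPl comp_lfunDl -comp_lfunZl.
by rewrite tpairPr comp_lfunDl -comp_lfunZl.
Qed.

HB.instance Definition _ A (Delta : 'Hom(A, tensor A A)) :=
  bilinear_isBilinear.Build F (dual A) (dual A) (dual A) *:%R *:%R
    (dual_mul Delta) (dual_mul_bilinear Delta).

Definition derivation A (mul : A -> A -> A) (d : 'End(A)) : Prop :=
  forall a b, d (mul a b) = mul (d a) b + mul a (d b).

Definition coderivation A (Delta : 'Hom(A, tensor A A)) (e : 'End(A)) : Prop :=
  forall a, Delta (e a) = (e \ot \1%VF + \1%VF \ot e) (Delta a).

Record ASI_bialgebra A (mu : {bilinear A -> A -> A})
    (Delta : 'Hom(A, tensor A A)) : Prop := {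
  asi_assoc : associative mu;
  asi_coassoc : coassociative Delta;
  asi_comul : forall a b, Delta (mu a b) =
    (rmul mu b \ot \1%VF) (Delta a) + (\1%VF \ot lmul mu a) (Delta b);
  asi_antisym : forall a b,
    (lmul mu a \ot \1%VF - \1%VF \ot rmul mu a) (Delta b) =
    tswap A A ((\1%VF \ot rmul mu b - lmul mu b \ot \1%VF) (Delta a))
}.

Record coherent_derivation A (mu : {bilinear A -> A -> A})
    (Delta : 'Hom(A, tensor A A)) (d e : 'End(A)) : Prop := {
  coh_derivation : derivation mu d;
  coh_coderivation : coderivation Delta e;
  coh_mull : forall a b, mu (e a) b = mu a (d b) + e (mu a b);
  coh_mulr : forall a b, mu a (e b) = mu (d a) b + e (mu a b);
  coh_comull : forall a,
    (d \ot \1%VF) (Delta a) = (\1%VF \ot e) (Delta a) + Delta (d a);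
  coh_comulr : forall a,
    (\1%VF \ot d) (Delta a) = (e \ot \1%VF) (Delta a) + Delta (d a)
}.

Definition pairwise_commuting V m (f : 'I_m -> 'End(V)) : Prop :=
  forall i j, (f i \o f j = f j \o f i)%VF.

Record differential_algebra A (mu : {bilinear A -> A -> A}) m
    (Phi : 'I_m -> 'End(A)) : Prop := {
  dalg_assoc : associative mu;
  dalg_derivation : forall k, derivation mu (Phi k);
  dalg_commuting : pairwise_commuting Phi
}.

Record differential_coalgebra A (Delta : 'Hom(A, tensor A A)) m
    (Psi : 'I_m -> 'End(A)) : Prop := {
  dcoalg_coassoc : coassociative Delta;
  dcoalg_coderivation : forall k, coderivation Delta (Psi k);
  dcoalg_commuting : pairwise_commuting Psi
}.

Record bimodule A (mu : {bilinear A -> A -> A}) V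
    (l r : 'Hom(A, 'End(V))) : Prop := {
  bimod_l : forall a b, (l a \o l b)%VF = l (mu a b);
  bimod_r : forall a b, (r b \o r a)%VF = r (mu a b);
  bimod_lr : forall a b, (r b \o l a = l a \o r b)%VF
}.

Record differential_bimodule A (mu : {bilinear A -> A -> A}) m
    (Phi : 'I_m -> 'End(A)) V (l r : 'Hom(A, 'End(V)))
    (alpha : 'I_m -> 'End(V)) : Prop := {
  dbimod_bimodule : bimodule mu l r;
  dbimod_commuting : pairwise_commuting alpha;
  dbimod_l : forall k a v,
    alpha k (l a v) = l (Phi k a) v + l a (alpha k v);
  dbimod_r : forall k a v,
    alpha k (r a v) = r (Phi k a) v + r a (alpha k v)
}.

Definition admissible A (mu : {bilinear A -> A -> A}) m
    (Phi Psi : 'I_m -> 'End(A)) : Prop :=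
  differential_bimodule mu Phi (dualrep (rmul mu)) (dualrep (lmul mu))
    (fun k => transpose (Psi k)).

(* The last field lives on A^**, the dual of the algebra A^*. *)
Record differential_ASI_bialgebra A (mu : {bilinear A -> A -> A})
    (Delta : 'Hom(A, tensor A A)) m (Phi Psi : 'I_m -> 'End(A)) : Prop := {
  dasi_ASI : ASI_bialgebra mu Delta;
  dasi_algebra : differential_algebra mu Phi;
  dasi_coalgebra : differential_coalgebra Delta Psi;
  dasi_admissible : admissible mu Phi Psi;
  dasi_coadmissible : admissible (dual_mul Delta)
    (fun k => transpose (Psi k)) (fun k => transpose (Phi k))
}.

(* The product of A \bowtie A^*; [LdualT] and [RdualT] are L_{A^*}^* and
   R_{A^*}^*, acting on A = A^**. *)

Definition star A (mu : {bilinear A -> A -> A}) (Delta : 'Hom(A, tensor A A))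
    (u w : (A * dual A)%type) : (A * dual A)%type :=
  let LdualT (y : dual A) : 'End(A) :=
    from_bidual (dualrep (lmul (dual_mul Delta)) y) in
  let RdualT (x : dual A) : 'End(A) :=
    from_bidual (dualrep (rmul (dual_mul Delta)) x) in
  (mu u.1 w.1 + LdualT w.2 u.1 + RdualT u.2 w.1,
   dual_mul Delta u.2 w.2 + dualrep (rmul mu) u.1 w.2
     + dualrep (lmul mu) w.1 u.2).

Lemma star_dual_pairing A (Delta : 'Hom(A, tensor A A)) (y z : dual A) a :
  z (from_bidual (dualrep (lmul (dual_mul Delta)) y) a) = dual_mul Delta y z a
  /\ z (from_bidual (dualrep (rmul (dual_mul Delta)) y) a) = dual_mul Delta z y a.
Proof.
by split; rewrite -bidualE from_bidualE dualrepE bidualE ?lmulE ?rmulE.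
Qed.

Definition double_map A (d e : 'End(A)) : 'End((A * dual A)%type) :=
  linfun (fun u : A * dual A => (d u.1, transpose e u.2)).

Lemma double_mapE A (d e : 'End(A)) u :
  double_map d e u = (d u.1, transpose e u.2).
Proof.
have lin : linear (fun u : (A * dual A)%type => (d u.1, transpose e u.2)).
  by move=> k x y /=; rewrite !linearP.
pose L := GRing.isLinear.Build F (A * dual A)%type
  (A * dual A)%type *:%R _ lin.
pose h : {linear (A * dual A)%type -> (A * dual A)%type} :=
  HB.pack (fun u : (A * dual A)%type => (d u.1, transpose e u.2)) L.
exact: (lfunE h).
Qed.

End Algebra.

(* Main.v *)
Require Import Defs.
From HB Require Import structures.
From mathcomp Require Import all_boot all_order all_algebra.
Import GRing.Theory.
Local Open Scope ring_scope.

(** All three conditions are one and the same list of identities, read through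
    the duality between [A] and its dual [A'].

    Write [o] for the product [dual_mul Delta] on [A'] and [f'] for the
    transpose of [f]. Say that [(d, e)] is compatible with a product when
    [e a * b = a * d b + e (a * b)] and [a * e b = d a * b + e (a * b)]
    ([compatible]). Functionals of the form [phi (x) psi] separate the points
    of [A (x) A] ([tpair_inj]), and the transpose of [f (x) g] sends
    [phi (x) psi] to [f' phi (x) g' psi] ([tpair_tmap]). Hence every identity
    about [Delta] is an identity about [o]: [e] is a coderivation iff [e'] is
    a derivation of [o], and the two conditions linking [Delta] to [d] and [e]
    say that [(e', d')] is compatible with [o]. So a coherent derivation
    consists of four conditions, symmetric under exchanging [(A, d, e)] and
    [(A', e', d')] ([coherent_derivationE]):
    - [d] is a derivation of [A] and [e'] is a derivation of [A'];
    - [(d, e)] is compatible with [A] and [(e', d')] with [A'].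

    The axioms of a differential ASI bialgebra reduce to this list: evaluating
    the dual bimodule at vectors of [A] turns admissibility into compatibility
    ([admissibleE]), while the remaining axioms of a bimodule hold by
    associativity, that of [o] being dual to coassociativity.

    So does the Leibniz rule on the double: pairing it with a functional [z]
    and with a vector [c] gives two scalar identities
    ([star_derivation_scalar]).
    Each is a sum of instances of the conditions above, and these instances
    involve different pairs among the four components of the two factors, so
    setting the other components to zero isolates each condition
    ([star_derivationE]). *)

(** * Separation of vectors and tensors by functionals *)

Section Duality.
Set Implicit Arguments.
Unset Strict Implicit.
Unset Printing Implicit Defensive.

Variable F : fieldType.
Local Notation dual V := 'Hom(V, F^o).
Implicit Types U V W X A : vectType F.

Lemma functional_inj V (u v : V) : (forall phi : dual V, phi u = phi v) -> u = v.
Proof.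
by move=> uv; apply: bidual_inj; apply/lfunP => phi; rewrite !bidualE uv.
Qed.

(** The functionals [phi (x) psi] separate tensors because those built from
    coordinate functionals are the matrix entries representing the tensor. *)
Lemma tpair_inj V W (s t : tensor V W) :
  (forall (phi : dual V) (psi : dual W), tpair phi psi s = tpair phi psi t) ->
  s = t.
Proof.
move=> st; apply/matrixP => i j.
pose entry (r : tensor V W) : F^o := (r : 'M[F]_(_, _)) i j.
have entry_lin : linear entry by move=> k x y; rewrite /entry !mxE.
pose L := GRing.isLinear.Build F (tensor V W) F^o *:%R _ entry_lin.
pose l : {linear tensor V W -> F^o} := HB.pack entry L.
pose phi : dual V := linfun (coord (vbasis {:V}) i : V -> F^o).
pose psi : dual W := linfun (coord (vbasis {:W}) j : W -> F^o).
have entryE : tpair phi psi = linfun l.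
  by apply: tensor_ext => v w; rewrite tpairE !lfunE /= /entry mxE.
by have := st phi psi; rewrite entryE !lfunE.
Qed.

Lemma tpair_tmap V V' W W' (f : 'Hom(V, V')) (g : 'Hom(W, W'))
    (phi : dual V') (psi : dual W') t :
  tpair phi psi ((f \ot g) t) = tpair (transpose f phi) (transpose g psi) t.
Proof.
suff /lfunP/(_ t) : (tpair phi psi \o (f \ot g))%VF =
    tpair (transpose f phi) (transpose g psi) by rewrite comp_lfunE.
by apply: tensor_ext => v w; rewrite comp_lfunE tmapE !tpairE !transposeE.
Qed.

(** Tensors of the form [pure t w] span, and fixing [w] reduces the claim to
    linear maps in [t], which pure tensors determine. *)
Lemma tensor3_ext U V W X (f g : 'Hom(tensor (tensor U V) W, X)) :
  (forall u v w, f (pure (pure u v) w) = g (pure (pure u v) w)) -> f = g.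
Proof.
move=> fg; apply: tensor_ext => t w.
have pure_lin : linear (fun s : tensor U V => pure s w).
  by move=> k x y; rewrite pureDl pureZl.
pose L := GRing.isLinear.Build F (tensor U V) (tensor (tensor U V) W) *:%R _
  pure_lin.
pose l : {linear tensor U V -> tensor (tensor U V) W} :=
  HB.pack (fun s : tensor U V => pure s w) L.
suff /lfunP/(_ t) : (f \o linfun l)%VF = (g \o linfun l)%VF.
  by rewrite !comp_lfunE !lfunE.
by apply: tensor_ext => u v; rewrite !comp_lfunE !lfunE; apply: fg.
Qed.

Lemma tpair_tassoc U V W (phi : dual U) (psi : dual V) (chi : dual W) t :
  tpair phi (tpair psi chi) (tassoc U V W t) = tpair (tpair phi psi) chi t.
Proof.
suff /lfunP/(_ t) : (tpair phi (tpair psi chi) \o tassoc U V W)%VF =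
    tpair (tpair phi psi) chi by rewrite comp_lfunE.
by apply: tensor3_ext => u v w; rewrite comp_lfunE tassocE !tpairE mulrA.
Qed.

(** * Identities for a coproduct as identities for the dual product *)

Lemma dual_mulE A (Delta : 'Hom(A, tensor A A)) (phi psi : dual A) a :
  dual_mul Delta phi psi a = tpair phi psi (Delta a).
Proof. exact: comp_lfunE. Qed.

Lemma transpose1 V (phi : dual V) : transpose \1%VF phi = phi.
Proof. by apply/lfunP => v; rewrite transposeE id_lfunE. Qed.

Lemma dual_mul_tensorl A (Delta : 'Hom(A, tensor A A)) (f : 'End(A)) phi psi a :
  tpair phi psi ((f \ot \1%VF) (Delta a)) = dual_mul Delta (transpose f phi) psi a.
Proof. by rewrite tpair_tmap transpose1 dual_mulE. Qed.

Lemma dual_mul_tensorr A (Delta : 'Hom(A, tensor A A)) (f : 'End(A)) phi psi a :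
  tpair phi psi ((\1%VF \ot f) (Delta a)) = dual_mul Delta phi (transpose f psi) a.
Proof. by rewrite tpair_tmap transpose1 dual_mulE. Qed.

Definition dual_mul_tensor := (dual_mul_tensorl, dual_mul_tensorr).

(** Both triple products of functionals are the functional
    [phi (x) psi (x) chi] composed with one of the two iterated coproducts. *)
Lemma dual_mul_assoc A (Delta : 'Hom(A, tensor A A)) :
  coassociative Delta -> associative (dual_mul Delta).
Proof.
move=> coassoc phi psi chi; apply/lfunP => a; rewrite !dual_mulE.
have dualE x y : dual_mul Delta x y = transpose Delta (tpair x y).
  by apply/lfunP => b; rewrite dual_mulE transposeE.
have lE := tpair_tmap \1%VF Delta phi (tpair psi chi) (Delta a).
have rE := tpair_tmap Delta \1%VF (tpair phi psi) chi (Delta a).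
rewrite !transpose1 in lE rE; rewrite !dualE -lE -rE.
by rewrite -tpair_tassoc coassoc.
Qed.

Lemma coderivationE A (Delta : 'Hom(A, tensor A A)) (e : 'End(A)) :
  coderivation Delta e <-> derivation (dual_mul Delta) (transpose e).
Proof.
have scalarE x y a : tpair x y ((e \ot \1%VF + \1%VF \ot e) (Delta a)) =
    (dual_mul Delta (transpose e x) y + dual_mul Delta x (transpose e y)) a.
  by rewrite !add_lfunE linearD /= !dual_mul_tensor.
split=> [coder x y | der a].
  by apply/lfunP => a; rewrite transposeE dual_mulE coder scalarE.
apply: tpair_inj => x y.
by rewrite -dual_mulE -transposeE der scalarE.
Qed.

(** The relation between [d] and [e] that makes the transpose of [e] a
    derivation, along [d], of the bimodule dual to the algebra. *)
Definition compatible A (mul : A -> A -> A) (d e : 'End(A)) : Prop :=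
  (forall a b, mul (e a) b = mul a (d b) + e (mul a b)) /\
  (forall a b, mul a (e b) = mul (d a) b + e (mul a b)).

(** The roles of [d] and [e] are exchanged because transposing turns the
    coderivation [e] into the derivation of the dual algebra. *)
Lemma cocompatibleE A (Delta : 'Hom(A, tensor A A)) (d e : 'End(A)) :
  ((forall a, (d \ot \1%VF) (Delta a) = (\1%VF \ot e) (Delta a) + Delta (d a)) /\
   (forall a, (\1%VF \ot d) (Delta a) = (e \ot \1%VF) (Delta a) + Delta (d a)))
  <-> compatible (dual_mul Delta) (transpose e) (transpose d).
Proof.
split=> [[dl dr] | [dl dr]]; split.
- move=> x y; apply/lfunP => a; rewrite add_lfunE transposeE.
  by rewrite -dual_mul_tensorl -dual_mul_tensorr dual_mulE dl linearD.
- move=> x y; apply/lfunP => a; rewrite add_lfunE transposeE.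
  by rewrite -dual_mul_tensorl -dual_mul_tensorr dual_mulE dr linearD.
- move=> a; apply: tpair_inj => x y; rewrite linearD /= !dual_mul_tensor dl.
  by rewrite add_lfunE transposeE [X in _ + X]dual_mulE.
- move=> a; apply: tpair_inj => x y; rewrite linearD /= !dual_mul_tensor dr.
  by rewrite add_lfunE transposeE [X in _ + X]dual_mulE.
Qed.

(** Here the coproduct enters only through the dual product, which makes the
    list self-dual; the two other notions are compared with this form. *)
Lemma coherent_derivationE A (mu : {bilinear A -> A -> A})
    (Delta : 'Hom(A, tensor A A)) (d e : 'End(A)) :
  coherent_derivation mu Delta d e <->
  [/\ derivation mu d, derivation (dual_mul Delta) (transpose e),
      compatible mu d e &
      compatible (dual_mul Delta) (transpose e) (transpose d)].
Proof.
split=> [[der coder ml mr cl cr] | [der /coderivationE coder [ml mr]]].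
  by split=> //; [apply/coderivationE | apply/cocompatibleE].
by case/cocompatibleE => cl cr; split.
Qed.

(** * Admissibility *)

Lemma dual_bimodule A (mu : {bilinear A -> A -> A}) :
  associative mu -> bimodule mu (dualrep (rmul mu)) (dualrep (lmul mu)).
Proof.
move=> assoc; split=> a b; apply/lfunP => v; apply/lfunP => c;
  by rewrite !comp_lfunE !dualrepE ?rmulE ?lmulE ?rmulE assoc.
Qed.

(** The Leibniz rules of the dual bimodule, evaluated at vectors, are the
    compatibility identities composed with an arbitrary functional. *)
Lemma admissibleE A (mu : {bilinear A -> A -> A}) m (Phi Psi : 'I_m -> 'End(A)) :
  associative mu -> pairwise_commuting Psi ->
  admissible mu Phi Psi <-> forall k, compatible mu (Phi k) (Psi k).
Proof.
move=> assoc comm; split=> [[_ _ leibR leibL] k | compat].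
  split=> a b; apply: functional_inj => v; rewrite linearD.
    move/(_ k b v)/lfunP/(_ a): leibR.
    by rewrite !(transposeE, add_lfunE, dualrepE, rmulE).
  move/(_ k a v)/lfunP/(_ b): leibL.
  by rewrite !(transposeE, add_lfunE, dualrepE, lmulE).
split; first exact: dual_bimodule.
- move=> i j; apply/lfunP => v; apply/lfunP => a.
  have /lfunP/(_ a) := comm i j.
  by rewrite !comp_lfunE !transposeE => ->.
- move=> k a v; apply/lfunP => b.
  rewrite !(transposeE, add_lfunE, dualrepE, rmulE) (compat k).1.
  exact: linearD.
- move=> k a v; apply/lfunP => b.
  rewrite !(transposeE, add_lfunE, dualrepE, lmulE) (compat k).2.
  exact: linearD.
Qed.

(** * Derivations of the double *)

(** The two scalar identities are the Leibniz rule for the product of [(a, x)]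
    and [(b, y)]: its component in [A] paired with a functional [z], and its
    component in the dual evaluated at a vector [c]. The pairing replaces the
    actions of the dual on [A], which are defined through the bidual, by
    products of functionals. *)
Lemma star_derivation_scalar A (mu : {bilinear A -> A -> A})
    (Delta : 'Hom(A, tensor A A)) (d e : 'End(A)) :
  derivation (star mu Delta) (double_map d e) <->
  forall (a b : A) (x y : dual A),
    (forall z : dual A,
       z (d (mu a b)) + dual_mul Delta y (transpose d z) a
         + dual_mul Delta (transpose d z) x b =
       z (mu (d a) b) + dual_mul Delta y z (d a)
         + dual_mul Delta z (transpose e x) b
       + (z (mu a (d b)) + dual_mul Delta (transpose e y) z a
         + dual_mul Delta z x (d b))) /\
    (forall c : A,
       dual_mul Delta x y (e c) + y (mu (e c) a) + x (mu b (e c)) =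
       dual_mul Delta (transpose e x) y c + y (mu c (d a))
         + x (e (mu b c))
       + (dual_mul Delta x (transpose e y) c + y (e (mu c a))
         + x (mu (d b) c))).
Proof.
pose Lact (y : dual A) : 'End(A) :=
  from_bidual (dualrep (lmul (dual_mul Delta)) y).
pose Ract (y : dual A) : 'End(A) :=
  from_bidual (dualrep (rmul (dual_mul Delta)) y).
have LactE y (z : dual A) a : z (Lact y a) = dual_mul Delta y z a.
  exact: (star_dual_pairing Delta y z a).1.
have RactE y (z : dual A) a : z (Ract y a) = dual_mul Delta z y a.
  exact: (star_dual_pairing Delta y z a).2.
(* [d] applied to an action term moves over to the functional [z]. *)
have dLactE y (z : dual A) a :
    z (d (Lact y a)) = dual_mul Delta y (transpose d z) a.
  by rewrite -LactE transposeE.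
have dRactE y (z : dual A) a :
    z (d (Ract y a)) = dual_mul Delta (transpose d z) y a.
  by rewrite -RactE transposeE.
have starE u w : star mu Delta u w =
  (mu u.1 w.1 + Lact w.2 u.1 + Ract u.2 w.1,
   dual_mul Delta u.2 w.2 + dualrep (rmul mu) u.1 w.2
     + dualrep (lmul mu) w.1 u.2) by [].
have repE := (add_lfunE, transposeE, dualrepE, lmulE, rmulE).
split=> [der a b x y | scal [a x] [b y]].
  move: (der (a, x) (b, y)); rewrite !double_mapE !starE /= => -[eq1 eq2].
  split=> [z | c].
    move/(congr1 z): eq1; rewrite !linearD /=.
    by rewrite dLactE dRactE !LactE !RactE.
  by move/lfunP/(_ c): eq2; rewrite !repE.
rewrite !double_mapE !starE /=; congr pair.
  apply: functional_inj => z; have := (scal a b x y).1 z.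
  rewrite !linearD /=.
  by rewrite dLactE dRactE !LactE !RactE.
by apply/lfunP => c; have := (scal a b x y).2 c; rewrite !repE.
Qed.

(** The scalar identities hold as soon as the four conditions do, by adding
    them up; conversely each condition is what is left of one of them when all
    but two of [a], [b], [x] and [y] vanish. *)
Lemma star_derivationE A (mu : {bilinear A -> A -> A})
    (Delta : 'Hom(A, tensor A A)) (d e : 'End(A)) :
  derivation (star mu Delta) (double_map d e) <->
  [/\ derivation mu d, derivation (dual_mul Delta) (transpose e),
      compatible mu d e &
      compatible (dual_mul Delta) (transpose e) (transpose d)].
Proof.
apply: iff_trans (star_derivation_scalar mu Delta d e) _.
have zeroE := (linear0l, linear0r, linear0, zero_lfunE, add0r, addr0).
split=> [scal | [der coder [ml mr] [cl cr]] a b x y].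
  split; [| | split | split].
  - move=> a b; apply: functional_inj => z.
    by have := (scal a b 0 0).1 z; rewrite !zeroE linearD.
  - move=> x y; apply/lfunP => c; rewrite transposeE add_lfunE.
    by have := (scal 0 0 x y).2 c; rewrite !zeroE.
  - move=> c a; apply: functional_inj => y.
    by have := (scal a 0 0 y).2 c; rewrite !zeroE linearD.
  - move=> b c; apply: functional_inj => x.
    by have := (scal 0 b x 0).2 c; rewrite !zeroE linearD /= addrC.
  - move=> z x; apply/lfunP => b; rewrite add_lfunE transposeE.
    by have := (scal 0 b x 0).1 z; rewrite !zeroE.
  - move=> y z; apply/lfunP => a; rewrite add_lfunE transposeE.
    by have := (scal a 0 0 y).1 z; rewrite !zeroE addrC.
(* Each term on the left expands into two terms by the condition that
   concerns it; regrouping the six terms gives the right-hand side. *)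
split=> [z | c].
  rewrite der cl cr !add_lfunE !transposeE linearD /=.
  by rewrite [LHS](AC (2*2*2) ((1*4*5)*(2*3*6))).
rewrite -transposeE coder ml mr !add_lfunE !linearD /=.
by rewrite [LHS](AC (2*2*2) ((1*3*6)*(2*4*5))).
Qed.
End Duality.

Theorem corollary3p16 (F : fieldType) (charF0 : [pchar F] =i pred0)
    (A : vectType F) (mu : {bilinear A -> A -> A})
    (Delta : 'Hom(A, tensor A A)) (asi : ASI_bialgebra mu Delta)
    (d e : 'End(A)) :
  (differential_ASI_bialgebra mu Delta (fun _ : 'I_1 => d) (fun _ : 'I_1 => e)
     <-> coherent_derivation mu Delta d e)
  /\ (coherent_derivation mu Delta d e
     <-> derivation (star mu Delta) (double_map d e)).
Proof.
have mu_assoc := asi_assoc asi.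
have dual_assoc := dual_mul_assoc (asi_coassoc asi).
have adm := @admissibleE F A mu 1 (fun=> d) (fun=> e) mu_assoc.
have coadm := @admissibleE F _ (dual_mul Delta) 1 (fun=> transpose e)
  (fun=> transpose d) dual_assoc.
have comm (V : vectType F) (f : 'End(V)) :
  pairwise_commuting (fun _ : 'I_1 => f) by [].
have cohE := coherent_derivationE mu Delta d e.
split; last exact: iff_trans cohE (iff_sym (star_derivationE mu Delta d e)).
apply: iff_trans _ (iff_sym cohE); split.
  case=> _ [_ der _] [_ coder _].
  move=> /(adm (comm _ _)) compat /(coadm (comm _ _)) cocompat.
  split; [exact: der ord0 | exact/coderivationE/(coder ord0)
         | exact: compat ord0 | exact: cocompat ord0].
case=> der /coderivationE coder compat cocompat.
split=> //.
- by split=> //; exact: (asi_coassoc asi).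
- exact/(adm (comm _ _)).
- exact/(coadm (comm _ _)).
Qed.
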